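(* Let $\mathcal H$ be a complex separable infinite-dimensional Hilbert space. Let $(\lambda_j)_{j\in\mathbb N}$ be a uniformly separated sequence in $\mathbb D$, $(e_j)_{j\in\mathbb N}$ an orthonormal basis for $\mathcal H$, and $f_0\in\mathcal H$ such that $|\langle f_0,e_j\rangle|\sim\sqrt{1-|\lambda_j|^2}$. For fixed $k,\ell\in\mathbb N$, $k\ne\ell$, and $\tau\in\mathbb C$ with $\tau\ne(\lambda_k-\lambda_\ell)\frac{\langle f_0,e_\ell\rangle}{\langle f_0,e_k\rangle}$, consider the bounded operator $T_\tau$ on $\mathcal H$ defined by $$T_\tau f:=\sum_{j=0}^\infty\lambda_j\langle f,e_j\rangle e_j+\tau\langle f,e_k\rangle e_\ell,\qquad f\in\mathcal H.$$ Then $(T_\tau^nf_0)_{n\in\mathbb N}$ is a frame for $\mathcal H$. For $\tau\ne0$ the operator $T_\tau$ is not normal.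
   Context: $\mathbb N=\{0,1,2,\dots\}$ and $\mathbb D$ is the open unit disk. A sequence $(\lambda_j)_{j\in\mathbb N}\subset\mathbb D$ is uniformly separated if $\inf_{j\in\mathbb N}\prod_{k\ne j}\left|\frac{\lambda_j-\lambda_k}{1-\overline{\lambda_j}\lambda_k}\right|>0$. For non-negative sequences, $a_j\sim b_j$ means that there are constants $c,C>0$ with $ca_j\le b_j\le Ca_j$ for all $j\in\mathbb N$. A system $(f_n)_{n\in\mathbb N}$ is a frame for $\mathcal H$ if there are $A,B>0$ with $A\|f\|^2\le\sum_n|\langle f,f_n\rangle|^2\le B\|f\|^2$ for all $f\in\mathcal H$. *)

(* Defs.v *)
From HB Require Import structures.
From mathcomp Require Import all_boot all_order all_algebra.
From mathcomp Require Import complex.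
From mathcomp Require Import all_classical all_reals all_analysis.
Set Implicit Arguments.
Unset Strict Implicit.
Unset Printing Implicit Defensive.
Import Order.TTheory GRing.Theory Num.Theory.
Import numFieldNormedType.Exports.
Import complex.ComplexField.Normc.
Local Open Scope classical_set_scope.
Local Open Scope ring_scope.

(* A complex Hilbert space over R[i] is a complete normed R[i]-module H with a
   positive definite hermitian form ip inducing its norm; ip u v is linear in u
   and conjugate-linear in v. *)
Definition induces_norm (R : realType) (H : completeNormedModType R[i])
    (ip : {dot H for Num.conj}) : Prop :=
  forall u : H, `|u| ^+ 2 = ip u u.

(* The library norms on R[i] and H take values in R[i] (on its nonnegative real
   axis); normc : R[i] -> R and normr_re below are their real-valued versions. *)
Definition normr_re (R : realType) (H : completeNormedModType R[i]) (u : H) : R :=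
  complex.Re `|u|.

Definition separable (T : topologicalType) : Prop :=
  exists D : set T, countable D /\ dense D.

Definition infinite_dimensional (K : fieldType) (V : lmodType K) : Prop :=
  forall (n : nat) (v : 'I_n -> V),
    exists x : V, forall c : 'I_n -> K, x <> \sum_(i < n) c i *: v i.

Definition orthonormal_basis (R : realType) (H : completeNormedModType R[i])
    (ip : {dot H for Num.conj}) (e : nat -> H) : Prop :=
  (forall i j : nat, ip (e i) (e j) = (i == j)%:R) /\
  (forall f : H, series (fun j => ip f (e j) *: e j) @ \oo --> f).

Definition is_frame (R : realType) (H : completeNormedModType R[i])
    (ip : {dot H for Num.conj}) (f_ : nat -> H) : Prop :=
  exists A B : R, 0 < A /\ 0 < B /\
    forall f : H,
      ((A * normr_re f ^+ 2)%:E <= \sum_(0 <= n <oo) (normc (ip f (f_ n)) ^+ 2)%:E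
       /\ \sum_(0 <= n <oo) (normc (ip f (f_ n)) ^+ 2)%:E
          <= (B * normr_re f ^+ 2)%:E)%E.

(* All factors lie in [0, 1] for points of the disk, so the partial products
   are nonincreasing and limn below is an actual limit. *)
Definition uniformly_separated (R : realType) (lam : nat -> R[i]) : Prop :=
  0 < inf (range (fun j : nat =>
    limn (fun n : nat => \prod_(0 <= k < n | k != j)
      normc ((lam j - lam k) / (1 - Num.conj (lam j) * lam k))) : R)).

Definition asymp_equiv (R : realType) (a b : nat -> R) : Prop :=
  exists c C : R, 0 < c /\ 0 < C /\
    forall j : nat, c * a j <= b j /\ b j <= C * a j.

Definition bounded_operator (R : realType) (H : completeNormedModType R[i])
    (T : H -> H) : Prop :=
  linear T /\ exists M : R, forall f : H, normr_re (T f) <= M * normr_re f.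

Definition is_adjoint (R : realType) (H : completeNormedModType R[i])
    (ip : {dot H for Num.conj}) (T S : H -> H) : Prop :=
  forall u v : H, ip (T u) v = ip u (S v).

(* The adjoint of a bounded operator on a Hilbert space exists and is unique. *)
Definition normal_operator (R : realType) (H : completeNormedModType R[i])
    (ip : {dot H for Num.conj}) (T : H -> H) : Prop :=
  exists S : H -> H, is_adjoint ip T S /\ forall f : H, T (S f) = S (T f).

Section PerturbedDiagonal.
Context (R : realType) (H : completeNormedModType R[i]).
Variables (ip : {dot H for Num.conj}) (lam : nat -> R[i]) (e : nat -> H).

Definition diag_series (f : H) : nat -> H :=
  series (fun j : nat => (lam j * ip f (e j)) *: e j).

Definition Ttau (k l : nat) (tau : R[i]) (f : H) : H :=
  limn (diag_series f) + (tau * ip f (e k)) *: e l.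

End PerturbedDiagonal.

(* Main.v *)
(* Expanding f0 in eigenvectors of T_tau (e_k is replaced by
   e_k + tau / (lam_k - lam_l) e_l), the coefficients of f0 are still comparable to
   w_j = sqrt (1 - |lam_j|^2); the condition on tau says that the l-th one is not 0.
   So the claim is that the vectors w_j (conj lam_j ^ n)_n form a Riesz sequence in
   l^2, i.e. that the Gram matrices G = (w_i w_j / (1 - conj lam_i lam_j)) of finite
   subfamilies are bounded above and below, uniformly.
   Above: G is dominated by the Gram matrix of Poisson kernels, whose entries are
   positive and at most R_ij = w_i w_j (w_i^2 + w_j^2) / |1 - conj lam_i lam_j|^2.
   Uniform separation bounds sum_k w_i^2 w_k^2 / |1 - conj lam_i lam_k|^2, and
   R = S + S^T with S S^T <= C R entrywise, so S is bounded.
   Below: G^-1 = D conj(G) D^*, with D the diagonal matrix of the inverses of the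
   Blaschke products at the lam_j, and |D| <= 1 / delta. *)
Require Import Defs.
From HB Require Import structures.
From mathcomp Require Import all_boot all_order all_algebra.
From mathcomp Require Import complex.
From mathcomp Require Import all_classical all_reals all_analysis.
From mathcomp Require Import ring lra.
Set Implicit Arguments.
Unset Strict Implicit.
Unset Printing Implicit Defensive.
Import Order.TTheory GRing.Theory Num.Theory.
Import numFieldNormedType.Exports.
Import complex.ComplexField.Normc.
Local Open Scope classical_set_scope.
Local Open Scope ring_scope.
Local Open Scope complex_scope.

(** * Modulus, real part and conjugation of complex numbers *)

Section ComplexModulus.
Variable R : rcfType.
Implicit Types (x y : R[i]) (r : R).

Lemma normc_real r : normc r%:C = `|r|.
Proof. by rewrite /normc /= expr0n addr0 sqrtr_sqr. Qed.

Lemma normc_ge0 x : 0 <= normc x.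
Proof. by case: x => a b; exact: sqrtr_ge0. Qed.

Lemma normc_gt0 x : x != 0 -> 0 < normc x.
Proof.
move=> x0; rewrite lt_neqAle normc_ge0 andbT eq_sym.
by apply: contra x0 => /eqP/eq0_normc ->.
Qed.

Lemma normcX x n : normc (x ^+ n) = normc x ^+ n.
Proof. by elim: n => [|n IH]; rewrite ?expr0 ?normc1 // !exprS normcM IH. Qed.

Lemma normc_conj x : normc (Num.conj x) = normc x.
Proof. by case: x => a b /=; rewrite sqrrN. Qed.

Lemma normc_prod I (s : seq I) (P : pred I) (F : I -> R[i]) :
  normc (\prod_(i <- s | P i) F i) = \prod_(i <- s | P i) normc (F i).
Proof. by apply: big_morph; [exact: normcM | exact: normc1]. Qed.

Lemma ler_normc_sum I (s : seq I) (P : pred I) (F : I -> R[i]) :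
  normc (\sum_(i <- s | P i) F i) <= \sum_(i <- s | P i) normc (F i).
Proof.
apply: (big_ind2 (fun x r => normc x <= r)) => [|x p y q xp yq|//].
  by rewrite (@normc0 R).
by apply: le_trans (le_normcD _ _) _; exact: lerD.
Qed.

Lemma normc_sqr x : (normc x ^+ 2)%:C = x * Num.conj x.
Proof. by rewrite -sqr_normc -rmorphXn. Qed.

Lemma normc_sqrE x : normc x ^+ 2 = complex.Re x ^+ 2 + complex.Im x ^+ 2.
Proof. by case: x => p q /=; rewrite sqr_sqrtr ?addr_ge0 ?sqr_ge0. Qed.

Lemma normRe x : `|complex.Re x| <= normc x.
Proof. by case: x => p q /=; rewrite -sqrtr_sqr ler_wsqrtr // lerDl sqr_ge0. Qed.

Lemma Re_le_normc x : complex.Re x <= normc x.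
Proof. exact: le_trans (ler_norm _) (normRe x). Qed.

Lemma Re_conjc x : complex.Re (Num.conj x) = complex.Re x.
Proof. by case: x. Qed.

Lemma ReD x y : complex.Re (x + y) = complex.Re x + complex.Re y.
Proof. by case: x y => a b [c d]. Qed.

Lemma ReN x : complex.Re (- x) = - complex.Re x.
Proof. by case: x. Qed.

Lemma Re_realM r x : complex.Re (r%:C * x) = r * complex.Re x.
Proof. by case: x => a b /=; rewrite mul0r subr0. Qed.

Lemma Re_sum I (s : seq I) (P : pred I) (F : I -> R[i]) :
  complex.Re (\sum_(i <- s | P i) F i) = \sum_(i <- s | P i) complex.Re (F i).
Proof. by apply: (big_morph (@complex.Re R)) => // [[a b] [c d]]. Qed.

(* Specialized to [Num.conj]: simplification would turn it into the convertible
   but syntactically different [conjc], on which the generic morphism lemmas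
   no longer fire. *)
Lemma conjM x y : Num.conj (x * y) = Num.conj x * Num.conj y.
Proof. exact: rmorphM. Qed.

Lemma conjD x y : Num.conj (x + y) = Num.conj x + Num.conj y.
Proof. exact: rmorphD. Qed.

Lemma conjB x y : Num.conj (x - y) = Num.conj x - Num.conj y.
Proof. exact: rmorphB. Qed.

Lemma conjX x n : Num.conj (x ^+ n) = Num.conj x ^+ n.
Proof. exact: rmorphXn. Qed.

Lemma conjV x : Num.conj (x ^-1) = (Num.conj x)^-1.
Proof. exact: fmorphV. Qed.

Lemma conj1 : Num.conj (1 : R[i]) = 1.
Proof. exact: rmorph1. Qed.

Lemma conj0 : Num.conj (0 : R[i]) = 0.
Proof. exact: rmorph0. Qed.

Lemma conj_real r : Num.conj r%:C = r%:C.
Proof. exact: conjc_real. Qed.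

Definition conjE := (conjM, conjB, conjD, conjX, conjV, conj1, conj0, conj_real, @conjCK).

Lemma conj_sum I (s : seq I) (P : pred I) (F : I -> R[i]) :
  Num.conj (\sum_(i <- s | P i) F i) = \sum_(i <- s | P i) Num.conj (F i).
Proof. exact: rmorph_sum. Qed.

Lemma conj_prod I (s : seq I) (P : pred I) (F : I -> R[i]) :
  Num.conj (\prod_(i <- s | P i) F i) = \prod_(i <- s | P i) Num.conj (F i).
Proof. exact: rmorph_prod. Qed.

End ComplexModulus.

Lemma cvg_sum_seq (R : realFieldType) (I : Type) (s : seq I) (u : I -> nat -> R)
    (l : I -> R) :
  (forall i, u i K @[K --> \oo] --> l i) ->
  \sum_(i <- s) u i K @[K --> \oo] --> \sum_(i <- s) l i.
Proof.
move=> ul; elim: s => [|i s IH].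
  by rewrite big_nil; under eq_fun do rewrite big_nil; exact: cvg_cst.
by rewrite big_cons; under eq_fun do rewrite big_cons; exact: cvgD.
Qed.

(** * Carleson embedding for finite separated families *)

(** A further factor [y] keeps the bound because [y * ((1 + S) * p) + (1 - y) * (y * p) <= y + (1 -
    y)]. This turns a lower bound for a product into an upper bound for the sum of the [1 - x i]. *)
Lemma sum_one_sub_mul_prod_le (R : realFieldType) I (s : seq I) (P : pred I) (x : I -> R) :
  (forall i, 0 <= x i <= 1) ->
  (1 + \sum_(i <- s | P i) (1 - x i)) * \prod_(i <- s | P i) x i <= 1.
Proof.
move=> x01.
suff : (1 + \sum_(i <- s | P i) (1 - x i)) * \prod_(i <- s | P i) x i <= 1 /\
    0 <= \prod_(i <- s | P i) x i <= 1 by case.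
elim: s => [|i s [IH1 IH2]]; first by rewrite !big_nil; lra.
rewrite !big_cons; case: (P i) => //.
have := x01 i; set p := \prod_(_ <- _ | _) _ in IH1 IH2 *.
move: (\sum_(_ <- _ | _) _) IH1 IH2 => S; move: (x i) p => y p.
move=> IH1 /andP[p0 p1] /andP[y0 y1]; split; last by apply/andP; split; nra.
have h1 : y * ((1 + S) * p) <= y by rewrite ler_piMr.
have h2 : (1 - y) * (y * p) <= 1 - y by rewrite ler_piMr ?subr_ge0 // mulr_ile1.
lra.
Qed.

(* With [S i j = w i ^ 3 * w j / d i j ^ 2] the triangle inequality gives the
   entrywise bound [S S^T <= 2 M (S + S^T)], hence
   [|S^T a|^2 <= 4 M <a, S^T a>], which bounds [S] without any choice of test
   weights. *)
Lemma quasi_metric_kernel_bound (R : realFieldType) (n : nat)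
    (w : 'I_n -> R) (d : 'I_n -> 'I_n -> R) (M : R) :
  (forall i, 0 < w i) -> (forall i j, 0 < d i j) ->
  (forall i j, d i j = d j i) -> (forall i j k, d i j <= d i k + d j k) ->
  (forall i, \sum_k w i ^+ 2 * w k ^+ 2 / d i k ^+ 2 <= M) ->
  forall a : 'I_n -> R, (forall i, 0 <= a i) ->
  \sum_i \sum_j a i * a j * (w i * w j * (w i ^+ 2 + w j ^+ 2) / d i j ^+ 2)
    <= 8 * M * \sum_i a i ^+ 2.
Proof.
move=> w0 d0 dC dtri wM a a0.
pose S i j := w i ^+ 3 * w j / d i j ^+ 2.
pose y k := \sum_i a i * S i k.
have SS i j : \sum_k S i k * S j k <= 2 * M * (S i j + S j i).
  have SSk k : S i k * S j k <= 2 * (S j i * (w i ^+ 2 * w k ^+ 2 / d i k ^+ 2)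
                            + S i j * (w j ^+ 2 * w k ^+ 2 / d j k ^+ 2)).
    (* With denominators cleared this is [d i j ^+ 2 <= 2 * d i k ^+ 2 + 2 * d j k ^+ 2], which
       follows from the triangle inequality. *)
    rewrite /S (dC j i) -subr_ge0.
    have -> : 2 * (w j ^+ 3 * w i / d i j ^+ 2 * (w i ^+ 2 * w k ^+ 2 / d i k ^+ 2) +
       w i ^+ 3 * w j / d i j ^+ 2 * (w j ^+ 2 * w k ^+ 2 / d j k ^+ 2)) -
       w i ^+ 3 * w k / d i k ^+ 2 * (w j ^+ 3 * w k / d j k ^+ 2) =
       w i ^+ 3 * w j ^+ 3 * w k ^+ 2 / (d i j ^+ 2 * d i k ^+ 2 * d j k ^+ 2) *
       (2 * d i k ^+ 2 + 2 * d j k ^+ 2 - d i j ^+ 2).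
      by field; rewrite !gt_eqF.
    apply: mulr_ge0; last first.
      have := dtri i j k; have := d0 i k; have := d0 j k; have := d0 i j.
      move: (d i j) (d i k) (d j k) => p q r p0 r0 q0 h.
      have : p ^+ 2 <= (q + r) ^+ 2 by rewrite lerXn2r ?nnegrE ?addr_ge0 // ltW.
      by have := sqr_ge0 (q - r); rewrite !sqrrD mulrN !sqrrN; lra.
    by rewrite divr_ge0 // !mulr_ge0 ?exprn_ge0 // ltW.
  apply: (le_trans (ler_sum _ (fun k _ => SSk k))).
  rewrite -mulr_sumr big_split /= -!mulr_sumr.
  have S0 p q : 0 <= S p q by rewrite divr_ge0 ?mulr_ge0 ?exprn_ge0 // ltW.
  have := ler_wpM2l (S0 i j) (wM j); have := ler_wpM2l (S0 j i) (wM i); lra.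
have formE : \sum_i \sum_j a i * a j * (w i * w j * (w i ^+ 2 + w j ^+ 2) / d i j ^+ 2)
    = \sum_i \sum_j a i * a j * (S i j + S j i).
  apply: eq_bigr => i _; apply: eq_bigr => j _; rewrite /S (dC j i).
  by field; rewrite gt_eqF.
have dotE : \sum_k a k * y k = \sum_i \sum_j a i * a j * S i j.
  rewrite exchange_big /=; apply: eq_bigr => k _; rewrite mulr_sumr.
  by apply: eq_bigr => i _; ring.
have dotE' : \sum_k a k * y k = \sum_i \sum_j a i * a j * S j i.
  apply: eq_bigr => k _; rewrite mulr_sumr.
  by apply: eq_bigr => i _; ring.
have form2 : \sum_i \sum_j a i * a j * (S i j + S j i) = 2 * \sum_k a k * y k.
  rewrite mulrDl mul1r {1}dotE dotE' -big_split; apply: eq_bigr => i _ /=.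
  by rewrite -big_split; apply: eq_bigr => j _ /=; rewrite mulrDr.
have Yle : \sum_k y k ^+ 2 <= 4 * M * \sum_k a k * y k.
  have -> : \sum_k y k ^+ 2 = \sum_i \sum_j a i * a j * \sum_k S i k * S j k.
    transitivity (\sum_k \sum_i \sum_j a i * a j * (S i k * S j k)).
      apply: eq_bigr => k _; rewrite expr2 mulr_suml; apply: eq_bigr => i _.
      by rewrite mulr_sumr; apply: eq_bigr => j _; ring.
    rewrite exchange_big; apply: eq_bigr => i _ /=.
    by rewrite exchange_big; apply: eq_bigr => j _; rewrite mulr_sumr.
  have -> : 4 * M * \sum_k a k * y k =
      \sum_i \sum_j a i * a j * (2 * M * (S i j + S j i)).
    rewrite (_ : 4 * M = 2 * M * 2) -?mulrA; last by ring.
    rewrite -form2 !mulr_sumr; apply: eq_bigr => i _.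
    by rewrite !mulr_sumr; apply: eq_bigr => j _; ring.
  by apply: ler_sum => i _; apply: ler_sum => j _; rewrite ler_wpM2l ?mulr_ge0.
(* Expanding these squares and inserting [Yle] gives [4 * M * \sum_k a k * y k <= 16 * M ^+ 2 *
   \sum_k a k ^+ 2]; it remains to divide by [4 * M]. *)
have sq : 0 <= \sum_k (y k - 4 * M * a k) ^+ 2 by apply: sumr_ge0 => k _; exact: sqr_ge0.
have sqE : \sum_k (y k - 4 * M * a k) ^+ 2 =
    \sum_k y k ^+ 2 - 8 * M * (\sum_k a k * y k) + 16 * M ^+ 2 * \sum_k a k ^+ 2.
  rewrite !mulr_sumr -sumrB -big_split; apply: eq_bigr => k _ /=; ring.
rewrite formE form2.
(* For [n = 0] the sign of [M] is unknown, but all sums are empty; for [n > 0] the diagonal term in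
   [wM] makes [M] positive. *)
have [n0|n0] := posnP n.
  by subst n; rewrite !big_ord0 !mulr0.
have M0 : 0 < M.
  apply: lt_le_trans (wM (Ordinal n0)).
  rewrite (bigD1 (Ordinal n0)) //=; apply: ltr_wpDr.
    by apply: sumr_ge0 => k _; rewrite divr_ge0 ?mulr_ge0 ?exprn_ge0 // ltW.
  by rewrite divr_gt0 ?mulr_gt0 ?exprn_gt0.
move: sqE sq Yle; move: (\sum_k (y k - _) ^+ 2) => X1 -> h1 h2.
have h3 : 4 * M * ((\sum_k a k * y k) - 4 * M * \sum_k a k ^+ 2) <= 0.
  move: h1 h2; move: (\sum_k y k ^+ 2) (\sum_k a k * y k) (\sum_k a k ^+ 2); move=> *; nra.
have h4 : (\sum_k a k * y k) - 4 * M * \sum_k a k ^+ 2 <= 0.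
  by move: h3; rewrite pmulr_rle0 // mulr_gt0.
lra.
Qed.

(** * Pseudohyperbolic geometry of the unit disk *)

Section Disk.
Variable R : rcfType.
Implicit Types x y z : R[i].

Lemma conj_mul_lt1 x y : normc x < 1 -> normc y < 1 -> normc (Num.conj x * y) < 1.
Proof. by move=> x1 y1; rewrite normcM normc_conj mulr_ilt1 ?normc_ge0. Qed.

Lemma one_sub_neq0 x : normc x < 1 -> 1 - x != 0.
Proof. by move=> x1; apply/eqP => /subr0_eq x_1; move: x1; rewrite -x_1 normc1 ltxx. Qed.

Lemma normc_one_sub_sqr x y : normc (1 - Num.conj x * y) ^+ 2 =
  normc (x - y) ^+ 2 + (1 - normc x ^+ 2) * (1 - normc y ^+ 2).
Proof. by rewrite !normc_sqrE; case: x y => a b [c d] /=; ring. Qed.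

Lemma normc_one_subC x y : normc (1 - Num.conj x * y) = normc (1 - Num.conj y * x).
Proof. by rewrite -normc_conj rmorphB rmorphM /= conjCK rmorph1 mulrC. Qed.

Lemma normc_one_sub_gt0 x y : normc x < 1 -> normc y < 1 -> 0 < normc (1 - Num.conj x * y).
Proof. by move=> x1 y1; rewrite normc_gt0 // one_sub_neq0 // conj_mul_lt1. Qed.

Lemma one_sub_normc_sqr_gt0 x : normc x < 1 -> 0 < 1 - normc x ^+ 2.
Proof. by move=> x1; rewrite subr_gt0 expr_lt1 ?normc_ge0. Qed.

(** The difference of [1 - Num.conj x * y] and [1 - Num.conj x * z] has modulus at most
    [normc (y - z)], which [normc_one_sub_sqr] bounds by [normc (1 - Num.conj y * z)]. *)
Lemma normc_one_sub_triangle x y z : normc x < 1 -> normc y < 1 -> normc z < 1 ->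
  normc (1 - Num.conj x * y) <= normc (1 - Num.conj x * z) + normc (1 - Num.conj y * z).
Proof.
move=> x1 y1 z1.
have -> : 1 - Num.conj x * y = (1 - Num.conj x * z) - Num.conj x * (y - z) by ring.
apply: le_trans (le_normcD _ _) _; rewrite lerD2l.
rewrite normcN normcM normc_conj; apply: le_trans (ler_piMl (normc_ge0 _) (ltW x1)) _.
rewrite -(@ler_pXn2r _ 2) ?nnegrE ?normc_ge0 // normc_one_sub_sqr lerDl.
by rewrite mulr_ge0 // ltW // one_sub_normc_sqr_gt0.
Qed.

(** The pseudohyperbolic distance, that is, one factor in the definition of uniform separation. *)
Definition pseudo_dist x y := normc ((x - y) / (1 - Num.conj x * y)).

Lemma pseudo_dist_ge0 x y : 0 <= pseudo_dist x y.
Proof. exact: normc_ge0. Qed.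

Lemma one_sub_pseudo_dist_sqr x y : normc x < 1 -> normc y < 1 ->
  1 - pseudo_dist x y ^+ 2 =
  (1 - normc x ^+ 2) * (1 - normc y ^+ 2) / normc (1 - Num.conj x * y) ^+ 2.
Proof.
move=> x1 y1; have d0 := normc_one_sub_gt0 x1 y1.
rewrite /pseudo_dist normcM normcV expr_div_n.
have := normc_one_sub_sqr x y; set N := normc (1 - _) in d0 *; set S := normc (x - y).
move=> E; have -> : (1 - normc x ^+ 2) * (1 - normc y ^+ 2) = N ^+ 2 - S ^+ 2 by rewrite E; ring.
by field; rewrite gt_eqF.
Qed.

Lemma pseudo_dist_le1 x y : normc x < 1 -> normc y < 1 -> pseudo_dist x y <= 1.
Proof.
move=> x1 y1; rewrite -(@expr_le1 _ 2) ?pseudo_dist_ge0 // -subr_ge0 one_sub_pseudo_dist_sqr //.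
by rewrite divr_ge0 ?sqr_ge0 // mulr_ge0 // ltW // one_sub_normc_sqr_gt0.
Qed.

End Disk.

(** * Gram matrices of normalized Szego kernels and their upper bound *)

Section FiniteGram.
Variables (R : realType) (n : nat) (lam : 'I_n -> R[i]).
Hypothesis lam_disk : forall i, normc (lam i) < 1.
Implicit Types a b : 'I_n -> R[i].

Definition wt i : R := Num.sqrt (1 - normc (lam i) ^+ 2).
(** Inner product in l^2 of the sequences [wt i * conj (lam i) ^ m] and [wt j * conj (lam j) ^ m],
    which [wt] makes unit vectors. *)
Definition szego i j : R[i] := (wt i * wt j)%:C / (1 - Num.conj (lam i) * lam j).
Definition gram a b : R[i] := \sum_i \sum_j a i * Num.conj (b j) * szego i j.
(** Partial sums of the squared l^2 norm of the combination, with coefficients [a], of these unit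
    vectors. The frame sums of the orbit are reduced to this form. *)
Definition moment_sum a (K : nat) : R :=
  \sum_(m < K) normc (\sum_i a i * (wt i)%:C * Num.conj (lam i) ^+ m) ^+ 2.

Lemma wt_gt0 i : 0 < wt i.
Proof. by rewrite sqrtr_gt0 one_sub_normc_sqr_gt0. Qed.

Lemma wt_sqr i : wt i ^+ 2 = 1 - normc (lam i) ^+ 2.
Proof. by rewrite sqr_sqrtr // ltW // one_sub_normc_sqr_gt0. Qed.

Lemma szego_conj i j : Num.conj (szego i j) = szego j i.
Proof. by rewrite /szego !conjE (mulrC (wt i)) (mulrC (lam i)). Qed.

Lemma gramC a b : Num.conj (gram a b) = gram b a.
Proof.
rewrite /gram conj_sum exchange_big; apply: eq_bigr => j _.
rewrite conj_sum; apply: eq_bigr => i _.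
by rewrite conjM szego_conj conjM conjCK (mulrC (b _)).
Qed.

(** Summing the finite geometric series in [m] leaves a remainder with the factors
    [(Num.conj (lam i) * lam j) ^+ K], which tend to 0. *)
Lemma moment_sumE a K : moment_sum a K = complex.Re (gram a a) -
  complex.Re (\sum_i \sum_j a i * Num.conj (a j) * szego i j *
     (Num.conj (lam i) * lam j) ^+ K).
Proof.
pose t m := \sum_i a i * (wt i)%:C * Num.conj (lam i) ^+ m.
have -> : moment_sum a K = complex.Re (\sum_(m < K) t m * Num.conj (t m)).
  by rewrite Re_sum; apply: eq_bigr => m _; rewrite -normc_sqr.
rewrite -ReN -ReD; congr complex.Re.
transitivity (\sum_(m < K) \sum_i \sum_j a i * Num.conj (a j) * (wt i * wt j)%:C
     * (Num.conj (lam i) * lam j) ^+ m).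
  apply: eq_bigr => m _; rewrite /t mulr_suml; apply: eq_bigr => i _.
  rewrite conj_sum mulr_sumr; apply: eq_bigr => j _.
  by rewrite !conjE exprMn [X in _ = _ * X * _]rmorphM; ring.
rewrite exchange_big -sumrN -big_split; apply: eq_bigr => i _ /=.
rewrite exchange_big -sumrN -big_split; apply: eq_bigr => j _ /=.
rewrite -mulr_sumr /szego.
have := one_sub_neq0 (conj_mul_lt1 (lam_disk i) (lam_disk j)).
move: (Num.conj (lam i) * lam j) => z z1.
have zE : (1 - z) * \sum_(m < K) z ^+ m = 1 - z ^+ K.
  by rewrite -opprB mulNr -subrX1 opprB.
rewrite -{1}(mulfVK z1 (_ * _)%:C); move: (\sum_(m < K) _) zE => S zE.
transitivity (a i * Num.conj (a j) * ((wt i * wt j)%:C / (1 - z)) * ((1 - z) * S)); first by ring.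
by rewrite zE; ring.
Qed.

Lemma cvg_moment_sum a : moment_sum a K @[K --> \oo] --> complex.Re (gram a a).
Proof.
apply/cvgrPdist_le => e e0.
pose c i j := normc (a i * Num.conj (a j) * szego i j).
have : (\sum_i \sum_j c i j * normc (Num.conj (lam i) * lam j) ^+ K) @[K --> \oo] --> (0 : R).
  have c0 : \sum_i \sum_j c i j * 0 = 0.
    by rewrite big1 // => i _; rewrite big1 // => j _; rewrite mulr0.
  rewrite -[X in _ --> X]c0.
  apply: cvg_sum_seq => i; apply: cvg_sum_seq => j.
  apply: cvgM; first exact: cvg_cst.
  by apply: cvg_expr; rewrite ger0_norm ?normc_ge0 // conj_mul_lt1.
move/cvgrPdist_le => /(_ e e0); apply: filterS => K; rewrite sub0r normrN => h.
apply: le_trans h; rewrite moment_sumE opprB addrC subrK.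
rewrite [leRHS]ger0_norm; last first.
  by do 2![apply: sumr_ge0 => ? _]; rewrite mulr_ge0 ?exprn_ge0 ?normc_ge0.
apply: le_trans (normRe _) _.
apply: le_trans (ler_normc_sum _ _ _) _; apply: ler_sum => i _.
apply: le_trans (ler_normc_sum _ _ _) _; apply: ler_sum => j _.
by rewrite normcM normcX.
Qed.

Lemma moment_sum_nd a : {homo moment_sum a : m p / (m <= p)%N >-> m <= p}.
Proof.
apply: (homo_leq lexx le_trans) => K.
by rewrite /moment_sum big_ord_recr lerDl sqr_ge0.
Qed.

Lemma moment_sum_le_gram a K : moment_sum a K <= complex.Re (gram a a).
Proof.
have cv := @cvg_moment_sum a.
rewrite -(cvg_lim (@Rhausdorff R) cv).
apply: nondecreasing_cvgn_le; [exact: moment_sum_nd | by apply/cvg_ex; eexists; exact: cv].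
Qed.

Lemma gram_le_of_moment_sum a (L : R) : (forall K, moment_sum a K <= L) ->
  complex.Re (gram a a) <= L.
Proof.
move=> h; have cv := @cvg_moment_sum a.
rewrite -(cvg_lim (@Rhausdorff R) cv); apply: limr_le.
  by apply/cvg_ex; eexists; exact: cv.
by near=> K; exact: h.
Unshelve. all: by end_near. Qed.

Lemma gram_ge0 a : 0 <= complex.Re (gram a a).
Proof. by apply: le_trans (moment_sum_le_gram a 0); rewrite /moment_sum big_ord0. Qed.

(* [Q = G + conj G - w w^T] has the positive entries
   [w_i w_j (1 - |lam_i lam_j|^2) / |1 - conj lam_i lam_j|^2] of the Gram matrix of
   Poisson kernels, and [G <= Q] because [conj G - w w^T] is positive semidefinite. *)
Lemma gram_le (M : R) a :
  (forall i, \sum_k wt i ^+ 2 * wt k ^+ 2 / normc (1 - Num.conj (lam i) * lam k) ^+ 2 <= M) ->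
  complex.Re (gram a a) <= 8 * M * \sum_i normc (a i) ^+ 2.
Proof.
move=> hM; pose a' i := Num.conj (a i).
pose s := \sum_i a i * (wt i)%:C.
(* The term [m = 0] of the moment sum of [a'] is [normc s ^+ 2]; this is the positivity of
   [conj G - w w^T]. *)
have h1 : normc s ^+ 2 <= complex.Re (gram a' a').
  apply: le_trans (moment_sum_le_gram a' 1).
  rewrite /moment_sum big_ord1 -normc_conj /s conj_sum.
  rewrite (eq_bigr (fun i => a' i * (wt i)%:C * Num.conj (lam i) ^+ 0)) // => i _.
  by rewrite expr0 mulr1 conjM conj_real.
pose d i j := normc (1 - Num.conj (lam i) * lam j).
pose q i j : R[i] := szego i j + szego j i - (wt i * wt j)%:C.
have qE i j : normc (q i j) <= wt i * wt j * (wt i ^+ 2 + wt j ^+ 2) / d i j ^+ 2.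
  have [wi wj] := (wt_gt0 i, wt_gt0 j).
  (* With [z = conj lam_i lam_j], this is the Poisson kernel identity [1 / (1 - z) + 1 / (1 - conj
     z) - 1 = (1 - |z|^2) / |1 - z|^2]. *)
  have -> : q i j = (wt i * wt j * (1 - (normc (lam i) * normc (lam j)) ^+ 2) / d i j ^+ 2)%:C.
    have dij := one_sub_neq0 (conj_mul_lt1 (lam_disk i) (lam_disk j)).
    have dji := one_sub_neq0 (conj_mul_lt1 (lam_disk j) (lam_disk i)).
    have realV (x y z : R) : (x * (1 - y) / z)%:C = x%:C * (1 - y%:C) / z%:C.
      by rewrite rmorphM rmorphM fmorphV rmorphB rmorph1.
    rewrite /q /szego /d -normcM realV !normc_sqr !conjE (mulrC (wt j)).
    by field; rewrite dij mulrC dji.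
  have n1 : (normc (lam i) * normc (lam j)) ^+ 2 <= 1.
    by rewrite exprn_ile1 ?mulr_ile1 ?mulr_ge0 ?normc_ge0 // ltW.
  rewrite normc_real ger0_norm; last by rewrite divr_ge0 ?sqr_ge0 // !mulr_ge0 ?subr_ge0 // ltW.
  rewrite ler_wpM2r ?invr_ge0 ?sqr_ge0 // ler_wpM2l ?mulr_ge0 ?(ltW wi) ?(ltW wj) //.
  (* Since [(1 - x) * (1 - y) >= 1 - x - y] for nonnegative [x] and [y], here the squared weights,
     the numerator is at most [wt i ^+ 2 + wt j ^+ 2]. *)
  have := wt_sqr i; have := wt_sqr j; rewrite exprMn.
  have := sqr_ge0 (wt i); have := sqr_ge0 (wt j).
  move: (wt i ^+ 2) (wt j ^+ 2) (normc _ ^+ 2) (normc _ ^+ 2) => x y u v; nra.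
have sumE : complex.Re (gram a a) + complex.Re (gram a' a') - normc s ^+ 2 =
    complex.Re (\sum_i \sum_j a i * Num.conj (a j) * q i j).
  have -> : normc s ^+ 2 = complex.Re (s * Num.conj s) by rewrite -normc_sqr.
  rewrite -ReD -ReN -ReD; congr complex.Re.
  have -> : gram a' a' = \sum_i \sum_j a i * Num.conj (a j) * szego j i.
    rewrite /gram exchange_big; apply: eq_bigr => i _; apply: eq_bigr => j _.
    by rewrite /a' conjCK (mulrC (a i)).
  rewrite /s conj_sum mulr_suml -big_split -sumrB; apply: eq_bigr => i _ /=.
  rewrite mulr_sumr -big_split -sumrB; apply: eq_bigr => j _ /=.
  by rewrite conjM conj_real /q rmorphM /=; ring.
have h2 : complex.Re (\sum_i \sum_j a i * Num.conj (a j) * q i j) <=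
    8 * M * \sum_i normc (a i) ^+ 2.
  apply: le_trans (quasi_metric_kernel_bound wt_gt0 _ _ _ hM (fun i => normc_ge0 (a i))).
  - apply: le_trans (Re_le_normc _) _.
    apply: le_trans (ler_normc_sum _ _ _) _; apply: ler_sum => i _.
    apply: le_trans (ler_normc_sum _ _ _) _; apply: ler_sum => j _.
    rewrite !normcM normc_conj ler_wpM2l ?mulr_ge0 ?normc_ge0 //; exact: qE.
  - by move=> i j; exact: normc_one_sub_gt0.
  - by move=> i j; exact: normc_one_subC.
  - by move=> i j k; exact: normc_one_sub_triangle.
lra.
Qed.

End FiniteGram.

(** * The inverse Gram matrix *)

(** The difference vanishes at [1, ..., size (p - q)], which are more distinct roots than its degree
    allows. *)
Lemma poly_eq_at0 (F : numFieldType) (p q : {poly F}) :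
  (forall x, x != 0 -> p.[x] = q.[x]) -> p.[0] = q.[0].
Proof.
move=> pq; suff -> : p = q by [].
apply/eqP; rewrite -subr_eq0; apply/eqP.
apply: (@roots_geq_poly_eq0 _ _ [seq i.+1%:R | i <- iota 0 (size (p - q)%R)]).
- by apply/allP => x /mapP[i _ ->]; rewrite rootE hornerD hornerN pq ?subrr // pnatr_eq0.
- by rewrite map_inj_uniq ?iota_uniq // => i j /eqP; rewrite eqr_nat => /eqP [].
- by rewrite size_map size_iota.
Qed.

Section CauchyInverse.
Variables (F : numFieldType) (n : nat) (lam mu : 'I_n -> F).
Hypothesis lam_inj : injective lam.

(* Lagrange interpolation of [prod_(m != j) (1 - mu m * y)] at the nodes [lam k],
   with [y] replaced by [1 / x] and denominators cleared. *)
Lemma reversed_lagrange j x :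
  \sum_k (\prod_(m | m != j) (1 - mu m * lam k)) *
         \prod_(m | m != k) ((1 - lam m * x) / (lam k - lam m))
  = \prod_(m | m != j) (x - mu m).
Proof.
have nz k : \prod_(m | m != k) (lam k - lam m) != 0.
  by apply/prodf_neq0 => m mk; rewrite subr_eq0 inj_eq // eq_sym.
pose c k := (\prod_(m | m != j) (1 - mu m * lam k)) / \prod_(m | m != k) (lam k - lam m).
have cE k y : (\prod_(m | m != j) (1 - mu m * lam k)) *
         \prod_(m | m != k) ((1 - lam m * y) / (lam k - lam m)) =
    c k * \prod_(m | m != k) (1 - lam m * y).
  by rewrite prodf_div /c; field; exact: nz.
rewrite (eq_bigr _ (fun k _ => cE k x)).
(* Both sides are polynomials in [x], so the case [x = 0] follows from the other values. *)
wlog x0 : x / x != 0 => [wlg|].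
  have [x0|] := eqVneq x 0; last exact: wlg.
  pose p := \sum_k (c k)%:P * \prod_(m | m != k) (1 - lam m *: 'X).
  pose q := \prod_(m | m != j) ('X - (mu m)%:P).
  have pE y : p.[y] = \sum_k c k * \prod_(m | m != k) (1 - lam m * y).
    rewrite horner_sum; apply: eq_bigr => k _; rewrite hornerM hornerC horner_prod.
    by congr (_ * _); apply: eq_bigr => m _; rewrite !hornerE.
  have qE y : q.[y] = \prod_(m | m != j) (y - mu m).
    by rewrite horner_prod; apply: eq_bigr => m _; rewrite !hornerE.
  rewrite x0 -pE -qE; apply: poly_eq_at0 => y y0; rewrite pE qE; exact: wlg.
(* Both terms have degree below [n] in ['X] and agree at the [n] nodes [lam k * x], which are
   distinct as [x != 0]. Hence [P = 0], and its value at 1 gives the claim. *)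
pose P := \sum_k c k *: \prod_(m | m != k) ('X - (lam m * x)%:P)
  - \prod_(m | m != j) (x%:P - mu m *: 'X).
have sz (f : 'I_n -> {poly F}) k : (forall m, (size (f m) <= 2)%N) ->
    (size (\prod_(m | m != k) f m)%R <= n)%N.
  move=> sf; apply: leq_trans (size_poly_prod_leq _ _) _.
  have cardk : #|[pred m : 'I_n | m != k]| = n.-1 by rewrite cardC1 card_ord.
  rewrite leq_subLR cardk.
  have -> : (n.-1 + n = (n.-1 * 2).+1)%N.
    by rewrite muln2 -addnn -addnS prednK // (leq_ltn_trans _ (ltn_ord k)).
  rewrite ltnS -cardk -sum_nat_const.
  by apply: leq_sum => m _; exact: sf.
have P0 : P = 0.
  apply: (@roots_geq_poly_eq0 _ _ [seq lam k * x | k <- enum 'I_n]).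
  - apply/allP => y /mapP[i _ ->]; rewrite rootE hornerD hornerN horner_sum.
    rewrite (bigD1 i) //= [X in _ + X - _]big1 ?addr0; last first.
      move=> k ki; rewrite hornerZ horner_prod (bigD1 i) 1?eq_sym //=.
      by rewrite hornerXsubC subrr mul0r mulr0.
    rewrite hornerZ !horner_prod /c mulrAC -!mulrA -prodf_div.
    under [X in _ * X - _]eq_bigr => m mi.
      rewrite hornerXsubC -mulrBl mulrAC divff ?mul1r; last by rewrite subr_eq0 inj_eq // eq_sym.
    over.
    under [X in _ - X]eq_bigr => m mi.
      rewrite !hornerE /= (_ : _ - _ = (1 - mu m * lam i) * x); last by ring.
    over.
    by rewrite big_split /= !prodr_const !cardC1 subrr.
  - rewrite map_inj_uniq ?enum_uniq // => k k' /(mulIf x0); exact: lam_inj.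
  - rewrite size_map size_enum_ord.
    apply: leq_trans (size_polyD _ _) _; rewrite size_polyN geq_max sz ?andbT.
      apply: leq_trans (size_sum _ _ _) _; apply/bigmax_leqP => k _.
      apply: leq_trans (size_scale_leq _ _) _; apply: sz => m.
      by rewrite size_XsubC.
    move=> m; apply: leq_trans (size_polyD _ _) _; rewrite geq_max size_polyN.
    by rewrite (leq_trans (size_polyC_leq1 _)) // (leq_trans (size_scale_leq _ _)) // size_polyX.
have : P.[1] = 0 by rewrite P0 horner0.
rewrite hornerD hornerN => /eqP; rewrite subr_eq0 => /eqP.
rewrite horner_sum horner_prod => PE.
transitivity (\sum_k (c k *: \prod_(m | m != k) ('X - (lam m * x)%:P)).[1]).
  apply: eq_bigr => k _; rewrite hornerZ horner_prod; congr (_ * _).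
  by apply: eq_bigr => m _; rewrite hornerXsubC.
by rewrite PE; apply: eq_bigr => m _; rewrite !hornerE.
Qed.

End CauchyInverse.

(** * Two-sided Gram bounds for finite separated families *)

Section FiniteRiesz.
Variables (R : realType) (n : nat) (lam : 'I_n -> R[i]) (delta : R).
Hypothesis lam_disk : forall i, normc (lam i) < 1.
Hypothesis delta_gt0 : 0 < delta.
Hypothesis lam_sep : forall j, delta <= \prod_(k | k != j) pseudo_dist (lam j) (lam k).
Implicit Types a b : 'I_n -> R[i].
Local Notation wt := (wt lam).
Local Notation gram := (gram lam).
Local Notation szego := (szego lam).
Local Notation moment_sum := (moment_sum lam).

Lemma separated_inj : injective lam.
Proof.
move=> i j lij; apply/eqP; apply: contraLR isT => ij.
have := lt_le_trans delta_gt0 (lam_sep j).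
by rewrite (bigD1 i) //= lij /pseudo_dist subrr mul0r (@normc0 R) mul0r ltxx.
Qed.

(** The terms are [1 - pseudo_dist (lam i) (lam k) ^+ 2], so [sum_one_sub_mul_prod_le] applies to
    the squared distances; the diagonal term supplies the summand 1 there. *)
Lemma separated_testing i :
  \sum_k wt i ^+ 2 * wt k ^+ 2 / normc (1 - Num.conj (lam i) * lam k) ^+ 2 <= (delta ^+ 2)^-1.
Proof.
pose x k := pseudo_dist (lam i) (lam k) ^+ 2.
have x01 k : 0 <= x k <= 1.
  by rewrite sqr_ge0 expr_le1 ?pseudo_dist_ge0 ?pseudo_dist_le1.
have := sum_one_sub_mul_prod_le (index_enum 'I_n) (fun k => k != i) x01.
have -> : 1 + \sum_(k | k != i) (1 - x k) = \sum_k (1 - x k).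
  by rewrite [RHS](bigD1 i) //= {2}/x /pseudo_dist subrr mul0r (@normc0 R) expr0n subr0.
have -> : \sum_k (1 - x k) =
    \sum_k wt i ^+ 2 * wt k ^+ 2 / normc (1 - Num.conj (lam i) * lam k) ^+ 2.
  by apply: eq_bigr => k _; rewrite one_sub_pseudo_dist_sqr // !wt_sqr.
set S := \sum_k _ => SP.
have S0 : 0 <= S by apply: sumr_ge0 => k _; rewrite divr_ge0 ?sqr_ge0 // mulr_ge0 ?sqr_ge0.
have pP : delta ^+ 2 <= \prod_(k | k != i) x k.
  rewrite /x prodrXl lerXn2r ?nnegrE ?(ltW delta_gt0) //.
  by apply: le_trans (lam_sep i); exact: ltW.
rewrite -[leRHS]div1r ler_pdivlMr ?exprn_gt0 //.
by apply: le_trans SP; rewrite ler_wpM2l.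
Qed.

Lemma separated_gram_le a :
  complex.Re (gram a a) <= 8 / delta ^+ 2 * \sum_i normc (a i) ^+ 2.
Proof. exact: (gram_le lam_disk _ separated_testing). Qed.

(** The value at [lam k] of the Blaschke product whose zeros are the other points. *)
Definition blaschke_factor k :=
  \prod_(m | m != k) ((lam k - lam m) / (1 - Num.conj (lam m) * lam k)).

Lemma normc_blaschke_factor k : delta <= normc (blaschke_factor k).
Proof.
apply: le_trans (lam_sep k) _; rewrite normc_prod le_eqVlt; apply/orP; left; apply/eqP.
by apply: eq_bigr => m _; rewrite /pseudo_dist !normcM !normcV normc_one_subC.
Qed.

Lemma blaschke_factor_neq0 k : blaschke_factor k != 0.
Proof.
apply/eqP => b0; have := lt_le_trans delta_gt0 (normc_blaschke_factor k).
by rewrite b0 (@normc0 R) ltxx.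
Qed.

(** After common factors are pulled out, the sum is [reversed_lagrange] at [x = Num.conj (lam i)]
    with [mu] the conjugates of [lam]. The resulting product has a zero factor unless [i = j]. *)
Lemma szego_inverse i j : \sum_k szego i k * szego j k / blaschke_factor k =
  (i == j)%:R * Num.conj (blaschke_factor j).
Proof.
have nz k m : 1 - Num.conj (lam k) * lam m != 0 by rewrite one_sub_neq0 // conj_mul_lt1.
have wtE k : (wt k)%:C * (wt k)%:C = 1 - Num.conj (lam k) * lam k.
  have real1B (r : R) : (1 - r)%:C = 1 - r%:C by rewrite rmorphB rmorph1.
  transitivity ((wt k ^+ 2)%:C); first by rewrite expr2 rmorphM.
  by rewrite wt_sqr // real1B normc_sqr mulrC.
pose c := (wt i)%:C * (wt j)%:C / \prod_m (1 - Num.conj (lam i) * lam m).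
transitivity (c * \prod_(m | m != j) (Num.conj (lam i) - Num.conj (lam m))).
  rewrite -(reversed_lagrange (fun m => Num.conj (lam m)) separated_inj) mulr_sumr.
  apply: eq_bigr => k _.
  have -> : \prod_(m | m != k) ((1 - lam m * Num.conj (lam i)) / (lam k - lam m)) =
      \prod_m (1 - Num.conj (lam i) * lam m) / (1 - Num.conj (lam i) * lam k) /
      \prod_(m | m != k) (lam k - lam m).
    rewrite prodf_div; congr (_ / _); rewrite [in RHS](bigD1 k) //= mulrAC divff // mul1r.
    by apply: eq_bigr => m _; rewrite mulrC.
  have -> : \prod_(m | m != j) (1 - Num.conj (lam m) * lam k) =
      (wt k)%:C * (wt k)%:C * \prod_(m | m != k) (1 - Num.conj (lam m) * lam k)
      / (1 - Num.conj (lam j) * lam k).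
    rewrite wtE; transitivity (\prod_m (1 - Num.conj (lam m) * lam k) / (1 - Num.conj (lam j) * lam k)).
      by rewrite [in RHS](bigD1 j) //= mulrAC divff // mul1r.
    by rewrite [in LHS](bigD1 k).
  rewrite /blaschke_factor prodf_div /c /szego !rmorphM.
  have p1 : \prod_(m | m != k) (1 - Num.conj (lam m) * lam k) != 0 by apply/prodf_neq0.
  have p2 : \prod_m (1 - Num.conj (lam i) * lam m) != 0 by apply/prodf_neq0.
  have p3 : \prod_(m | m != k) (lam k - lam m) != 0.
    by apply/prodf_neq0 => m mk; rewrite subr_eq0 (inj_eq separated_inj) eq_sym.
  by field; rewrite p1 p2 p3 !nz.
have [eij|ij] := eqVneq i j; last first.
  by rewrite (bigD1 i) //= subrr mul0r mulr0 mul0r.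
rewrite mul1r /c eij wtE (bigD1 j) //= conj_prod.
under [in RHS]eq_bigr => m _.
  rewrite !conjE (mulrC (lam m)); over.
rewrite prodf_div; field.
by rewrite nz andbT; apply/prodf_neq0.
Qed.

(* Positivity of the Gram form at [a - t b], where [b] solves [G b = a] and
   [t = delta ^ 4 / 8]. *)
Lemma separated_gram_ge a :
  delta ^+ 4 / 8 * \sum_i normc (a i) ^+ 2 <= complex.Re (gram a a).
Proof.
pose bt := blaschke_factor.
(* By [szego_inverse], this choice makes [gram c b] the standard inner product of [c] with [a]. *)
pose b i := Num.conj (\sum_k (bt i)^-1 * szego k i / Num.conj (bt k) * Num.conj (a k)).
have gramb c : gram c b = \sum_i c i * Num.conj (a i).
  apply: eq_bigr => i _.
  transitivity (c i * \sum_k Num.conj (a k) / Num.conj (bt k) *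
      \sum_j szego i j * szego k j / bt j).
    rewrite mulr_sumr /b; under eq_bigr do rewrite conjCK mulr_sumr mulr_suml.
    rewrite exchange_big; apply: eq_bigr => k _.
    by rewrite !mulr_sumr; apply: eq_bigr => j _; ring.
  congr (_ * _); rewrite (bigD1 i) //= [X in _ + X]big1 ?addr0.
    by rewrite /bt szego_inverse eqxx mul1r mulfVK // conjC_eq0 blaschke_factor_neq0.
  by move=> k ki; rewrite /bt szego_inverse eq_sym (negPf ki) mul0r mulr0.
set X := \sum_i _.
have gab : complex.Re (gram a b) = X.
  by rewrite gramb Re_sum; apply: eq_bigr => i _; rewrite -normc_sqr.
(* The inverse Gram matrix is the conjugate one between two diagonal matrices, so the form at [b]
   equals the form at [c], to which the upper bound applies. *)
pose c k := Num.conj (a k / bt k).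
have gbb : complex.Re (gram b b) = complex.Re (gram c c).
  rewrite -(Re_conjc (gram b b)) gramb; congr complex.Re.
  rewrite conj_sum /gram exchange_big; apply: eq_bigr => i _.
  rewrite conjM conjCK /b conjCK mulr_suml; apply: eq_bigr => k _.
  by rewrite /c conjCK !conjE; ring.
(* The upper Gram bound gives [8 / delta ^+ 2]; dividing by the Blaschke factors costs another
   [delta ^+ 2]. *)
pose kap := 8 / delta ^+ 4.
have kap0 : 0 < kap by rewrite divr_gt0 ?exprn_gt0.
have gbb_le : complex.Re (gram b b) <= kap * X.
  rewrite gbb; apply: le_trans (separated_gram_le c) _.
  rewrite /X !mulr_sumr; apply: ler_sum => i _.
  rewrite /c normc_conj normcM normcV expr_div_n.
  have -> : kap * normc (a i) ^+ 2 = 8 / delta ^+ 2 * (normc (a i) ^+ 2 / delta ^+ 2).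
    by rewrite /kap; field; rewrite gt_eqF.
  rewrite ler_wpM2l ?divr_ge0 ?sqr_ge0 // ler_wpM2l ?sqr_ge0 //.
  have d2 := normc_blaschke_factor i.
  rewrite lef_pV2 ?posrE ?exprn_gt0 ?(lt_le_trans delta_gt0 d2) //.
  by rewrite lerXn2r ?nnegrE ?(ltW delta_gt0) ?normc_ge0.
pose t := kap^-1.
have expand : complex.Re (gram (fun i => a i - t%:C * b i) (fun i => a i - t%:C * b i)) =
    complex.Re (gram a a) - 2 * t * X + t ^+ 2 * complex.Re (gram b b).
  have -> : gram (fun i => a i - t%:C * b i) (fun i => a i - t%:C * b i) =
      gram a a - t%:C * gram a b - t%:C * gram b a + (t ^+ 2)%:C * gram b b.
    rewrite /gram !mulr_sumr -!sumrB -big_split; apply: eq_bigr => i _ /=.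
    rewrite !mulr_sumr -!sumrB -big_split; apply: eq_bigr => j _ /=.
    by rewrite !conjE rmorphXn /=; ring.
  have gba : complex.Re (gram b a) = X by rewrite -gramC Re_conjc.
  rewrite !(ReD, ReN, Re_realM) gab gba; ring.
have := gram_ge0 lam_disk (fun i => a i - t%:C * b i).
rewrite expand => h.
have tk : t * kap = 1 by rewrite mulVf // gt_eqF.
have t0 : 0 < t by rewrite invr_gt0.
have -> : delta ^+ 4 / 8 = t by rewrite /t /kap invf_div.
(* As [t = kap^-1], the quadratic term absorbs half of [2 * t * X] and leaves [t * X] as the lower
   bound. *)
have : t ^+ 2 * complex.Re (gram b b) <= t * X.
  rewrite expr2 -mulrA ler_wpM2l ?(ltW t0) //.
  by rewrite -[leRHS]mul1r -tk -mulrA ler_wpM2l // (ltW t0).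
lra.
Qed.

End FiniteRiesz.

(** * Hilbert space *)

Section InnerProduct.
Variables (R : realType) (H : completeNormedModType R[i]) (ip : {dot H for Num.conj}).
Hypothesis ip_norm : induces_norm ip.
Implicit Types (u v x y : H) (c : R[i]).
Local Notation nrm := (@normr_re R H).

Lemma ipC u v : ip u v = Num.conj (ip v u).
Proof. by rewrite hermC expr0 mul1r. Qed.

Lemma ipDl u v x : ip (u + v) x = ip u x + ip v x.
Proof. exact: linearDl. Qed.
Lemma ipBl u v x : ip (u - v) x = ip u x - ip v x.
Proof. by rewrite linearDl linearNl. Qed.
Lemma ipZl c u x : ip (c *: u) x = c * ip u x.
Proof. exact: linearZl_LR. Qed.
Lemma ipBr u v x : ip x (u - v) = ip x u - ip x v.
Proof. by rewrite ipC ipBl conjB -!ipC. Qed.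
Lemma ipDr u v x : ip x (u + v) = ip x u + ip x v.
Proof. by rewrite ipC ipDl conjD -!ipC. Qed.
Lemma ipZr c u x : ip x (c *: u) = Num.conj c * ip x u.
Proof. by rewrite ipC ipZl conjM -ipC. Qed.
Lemma ip_suml I (s : seq I) (F : I -> H) x :
  ip (\sum_(i <- s) F i) x = \sum_(i <- s) ip (F i) x.
Proof. exact: linear_sumlz. Qed.

Lemma normrE_re u : `|u| = (nrm u)%:C.
Proof.
have := normr_ge0 u; rewrite /normr_re; case: (`|u|) => p q.
by rewrite lecE /= => /andP[/eqP ->].
Qed.

Lemma normr_re_ge0 u : 0 <= nrm u.
Proof. by have := normr_ge0 u; rewrite normrE_re ler0c. Qed.

Lemma normr_reD u v : nrm (u + v) <= nrm u + nrm v.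
Proof. by have := ler_normD u v; rewrite !normrE_re -rmorphD lecR. Qed.

Lemma normr_reZ c u : nrm (c *: u) = normc c * nrm u.
Proof.
have := normrZ c u; rewrite !normrE_re.
by move=> /(congr1 (@complex.Re R)); rewrite [`|c|]/(normc c)%:C Re_realM.
Qed.

Lemma normr_re_sqrC u : (nrm u ^+ 2)%:C = ip u u.
Proof. by rewrite -ip_norm normrE_re -rmorphXn. Qed.

Lemma normr_re_sqr u : nrm u ^+ 2 = complex.Re (ip u u).
Proof. by rewrite -normr_re_sqrC. Qed.

Lemma normr_re_eq0 u : nrm u = 0 -> u = 0.
Proof. by move=> u0; apply/eqP; rewrite -normr_eq0 normrE_re u0. Qed.

Lemma ip_cauchy_schwarz u v : normc (ip u v) <= nrm u * nrm v.
Proof.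
have [v0|v0] := eqVneq (nrm v) 0.
  have -> : v = 0 by exact: normr_re_eq0.
  by rewrite linear0r (@normc0 R) mulr_ge0 // normr_re_ge0.
have vp : 0 < nrm v by rewrite lt_neqAle eq_sym v0 normr_re_ge0.
rewrite -(@ler_pXn2r _ 2) ?nnegrE ?normc_ge0 ?mulr_ge0 ?normr_re_ge0 //.
pose c := ip u v / (nrm v ^+ 2)%:C.
have := sqr_ge0 (nrm (u - c *: v)); rewrite normr_re_sqr.
have nz : (nrm v)%:C != 0 by rewrite (inj_eq (@complexI R)).
have -> : ip (u - c *: v) (u - c *: v) =
    (nrm u ^+ 2 - (normc (ip u v)) ^+ 2 / nrm v ^+ 2)%:C.
  have realE (p q r : R) : (p - q / r)%:C = p%:C - q%:C / r%:C.
    by rewrite rmorphB rmorphM fmorphV.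
  rewrite ipBl !ipBr ipZl !ipZr ipZl -!normr_re_sqrC realE normc_sqr.
  rewrite /c !conjE (ipC v u); field; exact: nz.
rewrite /= subr_ge0 ler_pdivrMr ?exprn_gt0 // exprMn //.
Qed.

Lemma cvg_normr_re (u : nat -> H) l : u @ \oo --> l ->
  nrm (l - u n) @[n --> \oo] --> (0 : R).
Proof.
move=> /cvgrPdist_lt ul; apply/cvgrPdist_lt => e e0.
have e0' : 0 < e%:C by rewrite ltcR.
apply: filterS (ul _ e0') => n.
by rewrite sub0r normrN (ger0_norm (normr_re_ge0 _)) normrE_re ltcR.
Qed.

(** Continuity of the inner product by Cauchy-Schwarz, in the form used for coordinates of a series:
    those of the partial sums are eventually constant. *)
Lemma ip_lim_eq (u : nat -> H) l v c : u @ \oo --> l ->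
  (\forall n \near \oo, ip (u n) v = c) -> ip l v = c.
Proof.
move=> /cvg_normr_re ul uc; apply/eqP; rewrite -subr_eq0; apply/eqP/(@eq0_normc R)/eqP.
rewrite eq_le normc_ge0 andbT.
have h : nrm (l - u n) * nrm v @[n --> \oo] --> 0 * nrm v.
  by apply: cvgM => //; exact: cvg_cst.
rewrite mul0r in h.
rewrite -(cvg_lim (@Rhausdorff R) h); apply: limr_ge; first by apply/cvg_ex; eexists; exact: h.
by apply: filterS uc => n <-; rewrite -ipBl ip_cauchy_schwarz.
Qed.

Variables (e : nat -> H).
Hypothesis e_onb : orthonormal_basis ip e.

Lemma ip_basis i j : ip (e i) (e j) = (i == j)%:R.
Proof. by have [h _] := e_onb; exact: h. Qed.

Lemma ip_basis_suml (s : seq nat) (c : nat -> R[i]) j : uniq s ->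
  ip (\sum_(i <- s) c i *: e i) (e j) = if j \in s then c j else 0.
Proof.
move=> us; rewrite ip_suml.
under eq_bigr => i _ do rewrite ipZl ip_basis mulr_natr mulrb.
case: ifPn => js.
  rewrite (bigD1_seq j) //= eqxx big1 ?addr0 // => i ij.
  by rewrite (negPf ij).
by rewrite big_seq big1 // => i is_; case: eqP => // ij; move: js; rewrite -ij is_.
Qed.

Lemma ip_suml_basis (s : seq nat) (c : nat -> R[i]) x :
  ip (\sum_(i <- s) c i *: e i) x = \sum_(i <- s) c i * Num.conj (ip x (e i)).
Proof. by rewrite ip_suml; apply: eq_bigr => i _; rewrite ipZl -ipC. Qed.

Lemma normr_re_basis_sum (s : seq nat) (c : nat -> R[i]) : uniq s ->
  nrm (\sum_(i <- s) c i *: e i) ^+ 2 = \sum_(i <- s) normc (c i) ^+ 2.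
Proof.
move=> us; rewrite normr_re_sqr ip_suml_basis Re_sum big_seq [RHS]big_seq.
by apply: eq_bigr => i is_; rewrite ip_basis_suml // is_ -normc_sqr.
Qed.

Definition trunc (N : nat) (f : H) : H := \sum_(0 <= j < N) ip f (e j) *: e j.

Lemma ip_trunc N f j : ip (trunc N f) (e j) = if (j < N)%N then ip f (e j) else 0.
Proof. by rewrite ip_basis_suml ?iota_uniq // mem_index_iota. Qed.

Lemma cvg_trunc f : nrm (f - trunc N f) @[N --> \oo] --> (0 : R).
Proof. by have [_ h] := e_onb; exact: cvg_normr_re (h f). Qed.

Lemma normr_re_trunc N f : nrm (trunc N f) ^+ 2 = \sum_(j < N) normc (ip f (e j)) ^+ 2.
Proof. by rewrite normr_re_basis_sum ?iota_uniq // big_mkord. Qed.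

Lemma trunc_pythagoras N f :
  nrm f ^+ 2 = nrm (trunc N f) ^+ 2 + nrm (f - trunc N f) ^+ 2.
Proof.
have o : ip (trunc N f) (f - trunc N f) = 0.
  rewrite ip_suml_basis big_seq big1 // => j; rewrite mem_index_iota => /andP[_ jN].
  by rewrite ipBl ip_trunc jN subrr conj0 mulr0.
have fE : f = trunc N f + (f - trunc N f) by rewrite addrC subrK.
rewrite {1}fE; move: (f - trunc N f) o => r o.
rewrite !normr_re_sqr -ReD; congr complex.Re.
by rewrite !(ipDl, ipDr) (ipC r) o conj0 addr0 add0r.
Qed.

Lemma normr_re_trunc_le N f : nrm (trunc N f) <= nrm f.
Proof.
rewrite -(@ler_pXn2r _ 2) ?nnegrE ?normr_re_ge0 // (trunc_pythagoras N f).
by rewrite lerDl sqr_ge0.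
Qed.

Lemma basis_ext f g : (forall j, ip f (e j) = ip g (e j)) -> f = g.
Proof.
move=> fg; apply/eqP; rewrite -subr_eq0; apply/eqP/normr_re_eq0.
have fg0 N : trunc N (f - g) = 0.
  by apply: big1 => j _; rewrite ipBl fg subrr scale0r.
have := cvg_trunc (f - g); under eq_fun do rewrite fg0 subr0.
by move/(cvg_lim (@Rhausdorff R)) <-; rewrite lim_cst.
Qed.

End InnerProduct.

(** * The perturbed diagonal operator: convergence, boundedness, non-normality, iterates *)

Section PerturbedDiagonalOperator.
Variables (R : realType) (H : completeNormedModType R[i]) (ip : {dot H for Num.conj}).
Hypothesis ip_norm : induces_norm ip.
Variables (e : nat -> H).
Hypothesis e_onb : orthonormal_basis ip e.
Variable lam : nat -> R[i].
Hypothesis lam_disk : forall j, normc (lam j) < 1.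
Local Notation nrm := (@normr_re R H).
Local Notation D f := (limn (diag_series ip lam e f)).

(** On blocks of consecutive indices this transfers the Cauchy criterion from the expansion of [f]
    to the diagonal series; on initial blocks it makes the diagonal operator a contraction. *)
Lemma diag_block_le (f : H) (s : seq nat) : uniq s ->
  nrm (\sum_(j <- s) (lam j * ip f (e j)) *: e j) <= nrm (\sum_(j <- s) ip f (e j) *: e j).
Proof.
move=> us; rewrite -(@ler_pXn2r _ 2) ?nnegrE ?normr_re_ge0 //.
rewrite !(normr_re_basis_sum ip_norm e_onb) //; apply: ler_sum => j _.
rewrite normcM exprMn ler_piMl ?sqr_ge0 // expr_le1 ?normc_ge0 //.
exact: ltW.
Qed.

Lemma cvg_diag_series f : cvgn (diag_series ip lam e f).
Proof.
have [_ /(_ f) /cvgP/cauchy_cvgP/cauchy_seriesP fc] := e_onb.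
apply/cauchy_cvgP/cauchy_seriesP => eps /fc; apply: filterS => n /=.
apply: le_lt_trans; rewrite !normrE_re lecR.
by apply: diag_block_le; rewrite iota_uniq.
Qed.

Lemma ip_diag f j : ip (D f) (e j) = lam j * ip f (e j).
Proof.
have cv : diag_series ip lam e f @ \oo --> D f by exact: cvg_diag_series.
apply: (ip_lim_eq ip_norm cv).
near=> n; rewrite /diag_series /series /= (ip_basis_suml e_onb) ?iota_uniq //.
rewrite mem_index_iota /= ifT //; near: n; exact: nbhs_infty_gt.
Unshelve. all: by end_near. Qed.

Lemma normr_re_diag_le f : nrm (D f) <= nrm f.
Proof.
have h : nrm (D f - diag_series ip lam e f n) @[n --> \oo] --> (0 : R).
  by apply: cvg_normr_re; exact: cvg_diag_series.
have h' : nrm (D f - diag_series ip lam e f n) + nrm f @[n --> \oo] --> 0 + nrm f.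
  by apply: cvgD => //; exact: cvg_cst.
rewrite add0r in h'.
rewrite -(cvg_lim (@Rhausdorff R) h'); apply: limr_ge; first by apply/cvg_ex; eexists; exact: h'.
near=> n.
rewrite -{1}(subrK (diag_series ip lam e f n) (D f)).
apply: le_trans (normr_reD _ _) _; rewrite lerD2l.
apply: le_trans (normr_re_trunc_le ip_norm e_onb n f).
by apply: diag_block_le; rewrite iota_uniq.
Unshelve. all: by end_near. Qed.

Variables (k l : nat) (tau : R[i]).
Local Notation T := (Ttau ip lam e k l tau).

Lemma ip_Ttau f j : ip (T f) (e j) = lam j * ip f (e j) + (j == l)%:R * tau * ip f (e k).
Proof.
by rewrite /Ttau ipDl ip_diag ipZl (ip_basis e_onb) (eq_sym l); ring.
Qed.

Lemma linear_Ttau : linear T.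
Proof.
move=> a u v; apply: (basis_ext e_onb) => j.
by rewrite !(ip_Ttau, ipDl, ipZl); ring.
Qed.

Lemma bounded_Ttau : bounded_operator T.
Proof.
split; first exact: linear_Ttau.
exists (1 + normc tau * nrm (e k) * nrm (e l)) => f; rewrite /Ttau.
apply: le_trans (normr_reD _ _) _; rewrite mulrDl mul1r.
apply: lerD; first exact: normr_re_diag_le.
rewrite normr_reZ normcM -!mulrA ler_wpM2l ?normc_ge0 //.
rewrite (mulrC (nrm (e l)) (nrm f)) mulrA (mulrC (nrm (e k)) (nrm f)).
by rewrite ler_wpM2r ?normr_re_ge0 // ip_cauchy_schwarz.
Qed.

Hypothesis lam_kl : lam k != lam l.

(* If [T S = S T] for the adjoint [S], then [S (e l)] is an eigenvector of [T] for
   [lam l], so its [k]-th coordinate, which is [conj tau], vanishes. *)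
Lemma not_normal_Ttau : tau <> 0 -> ~ normal_operator ip T.
Proof.
move=> tau0 [S [adj TS]]; apply: tau0.
have kl : k != l by apply: contra lam_kl => /eqP ->.
have Tel : T (e l) = lam l *: e l.
  apply: (basis_ext e_onb) => j.
  rewrite ip_Ttau ipZl !(ip_basis e_onb) (eq_sym l k) (negPf kl) mulr0 addr0.
  by have [->|] := eqVneq l j; rewrite ?mulr0.
(* [is_adjoint] does not include linearity of [S]; homogeneity is recovered by moving [S] across the
   inner product. *)
have SZ c u : S (c *: u) = c *: S u.
  apply: (basis_ext e_onb) => j.
  by rewrite ipC -adj ipZr conjM conjCK adj -ipC ipZl.
have := congr1 (ip^~ (e k)) (TS (e l)); rewrite Tel SZ ip_Ttau ipZl (negPf kl).
rewrite !mul0r addr0 => /eqP; rewrite -subr_eq0 -mulrBl mulf_eq0 subr_eq0 (negPf lam_kl) /=.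
rewrite ipC conjC_eq0 -adj ip_Ttau !(ip_basis e_onb) (negPf kl) eqxx eqxx => /eqP.
by rewrite mulr0 add0r mul1r mulr1.
Qed.

Hypothesis k_neq_l : k != l.

(** Since [tau = sigma * (lam k - lam l)], the vector [e k + sigma *: e l] is an eigenvector for
    [lam k]; this is why the [l]-th coordinate mixes powers of [lam k] and [lam l]. *)
Lemma ip_iter_Ttau (f : H) (m j : nat) (sigma := tau / (lam k - lam l)) :
  ip (iter m T f) (e j) = lam j ^+ m * ip f (e j) +
    (j == l)%:R * sigma * ip f (e k) * (lam k ^+ m - lam l ^+ m).
Proof.
elim: m j => [|m IH] j; first by rewrite !expr0 subrr mulr0 addr0 mul1r.
rewrite iterS ip_Ttau !IH (negPf k_neq_l) /sigma.
have nz : lam k - lam l != 0 by rewrite subr_eq0.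
have [->|_] := eqVneq j l; last by rewrite !mul0r !addr0 exprS mulrA.
by rewrite !mul0r addr0 !mul1r !exprS; field.
Qed.

End PerturbedDiagonalOperator.

(** * Reduction of the frame inequalities to truncations *)

Section FrameDensity.
Variables (R : realType) (H : completeNormedModType R[i]) (ip : {dot H for Num.conj}).
Hypothesis ip_norm : induces_norm ip.
Variables (e : nat -> H).
Hypothesis e_onb : orthonormal_basis ip e.
Local Notation nrm := (@normr_re R H).
Variable g : nat -> H.

Definition frame_sum (f : H) (K : nat) : R := \sum_(m < K) normc (ip f (g m)) ^+ 2.

(** Quantifying over the real upper bounds [L] of the partial sums keeps infinite sums out of the
    lower estimate: if the series is [+oo], that estimate is trivial. *)
Lemma is_frame_frame_sum (A B : R) : 0 < A -> 0 < B ->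
  (forall f K, frame_sum f K <= B * nrm f ^+ 2) ->
  (forall f L, (forall K, frame_sum f K <= L) -> A * nrm f ^+ 2 <= L) ->
  is_frame ip g.
Proof.
move=> A0 B0 up low; exists A, B; split => //; split => // f.
have pos n : (0 <= (normc (ip f (g n)) ^+ 2)%:E)%E by rewrite lee_fin sqr_ge0.
have partE K : (\sum_(0 <= n < K) (normc (ip f (g n)) ^+ 2)%:E)%E = (frame_sum f K)%:E.
  by rewrite sumEFin big_mkord.
split.
- have ge K : ((frame_sum f K)%:E <= \sum_(0 <= n <oo) (normc (ip f (g n)) ^+ 2)%:E)%E.
    by rewrite -partE; apply: nneseries_lim_ge => n _ _; exact: pos.
  move: ge; case: (\sum_(0 <= n <oo) _)%E => [r| |] ge.
  + by rewrite lee_fin; apply: low => K; have := ge K; rewrite lee_fin.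
  + by rewrite leey.
  + by have := ge 0%N; rewrite leeNy_eq.
- apply: lime_le; first by apply: is_cvg_nneseries => n _ _; exact: pos.
  by near=> K; rewrite partE lee_fin; exact: up.
Unshelve. all: by end_near. Qed.

(** For fixed [K] the upper bound passes to the limit in [N]. For the lower one, [trunc f] is [f]
    minus a remainder [r], and the upper bound controls the contribution of [r]; the factor 2 from
    squaring a sum halves [A]. *)
Lemma is_frame_of_trunc (A B : R) (N0 : nat) : 0 < A -> 0 < B ->
  (forall f N K, (N0 <= N)%N -> frame_sum (trunc ip e N f) K <= B * nrm (trunc ip e N f) ^+ 2) ->
  (forall f N L, (N0 <= N)%N -> (forall K, frame_sum (trunc ip e N f) K <= L) ->
     A * nrm (trunc ip e N f) ^+ 2 <= L) ->
  is_frame ip g.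
Proof.
move=> A0 B0 up low.
have up' f K : frame_sum f K <= B * nrm f ^+ 2.
  have cv m : normc (ip (trunc ip e N f) (g m)) @[N --> \oo] --> normc (ip f (g m)).
    have h : nrm (f - trunc ip e N f) * nrm (g m) @[N --> \oo] --> 0 * nrm (g m).
      by apply: cvgM; [exact: cvg_trunc | exact: cvg_cst].
    rewrite mul0r in h.
    apply/cvgrPdist_le => eps eps0.
    move/cvgrPdist_le : h => /(_ _ eps0); apply: filterS => N; rewrite sub0r normrN.
    apply: le_trans; rewrite [leRHS]ger0_norm ?mulr_ge0 ?normr_re_ge0 //.
    apply: le_trans (ip_cauchy_schwarz ip_norm _ _); rewrite ipBl.
    have tri (x y : R[i]) : normc x - normc y <= normc (x - y).
      by rewrite lerBlDr -{1}(subrK y x) le_normcD.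
    rewrite ler_norml tri andbT lerNl opprB -[leRHS]normcN opprB; exact: tri.
  have cvs : frame_sum (trunc ip e N f) K @[N --> \oo] --> frame_sum f K.
    by apply: cvg_sum_seq => m; rewrite !expr2; apply: cvgM; exact: cv.
  rewrite -(cvg_lim (@Rhausdorff R) cvs); apply: limr_le; first by apply/cvg_ex; eexists; exact: cvs.
  near=> N; apply: le_trans (up f N K _) _; first by near: N; exact: nbhs_infty_ge.
  rewrite ler_wpM2l ?(ltW B0) // lerXn2r ?nnegrE ?normr_re_ge0 //.
  exact: normr_re_trunc_le.
apply: (@is_frame_frame_sum (A / 2) B) => //; first by rewrite divr_gt0.
move=> f L hL.
(* By Pythagoras, [A * nrm f ^+ 2 - 2 * L] is at most [A + 2 * B] times the squared norm of the
   remainder, which tends to 0. *)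
have h : (A + 2 * B) * (nrm (f - trunc ip e N f) * nrm (f - trunc ip e N f)) @[N --> \oo]
    --> (A + 2 * B) * (0 * 0).
  by apply: cvgM; [exact: cvg_cst | apply: cvgM; exact: cvg_trunc].
rewrite !mulr0 in h.
suff : A * nrm f ^+ 2 - 2 * L <= 0 by lra.
rewrite -(cvg_lim (@Rhausdorff R) h); apply: limr_ge; first by apply/cvg_ex; eexists; exact: h.
near=> N.
have NN : (N0 <= N)%N by near: N; exact: nbhs_infty_ge.
set r := f - trunc ip e N f.
have pyth := trunc_pythagoras ip_norm e_onb N f.
have : A * nrm (trunc ip e N f) ^+ 2 <= 2 * L + 2 * (B * nrm r ^+ 2).
  apply: low => // K.
  have sq2 : frame_sum (trunc ip e N f) K <= 2 * frame_sum f K + 2 * frame_sum r K.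
    rewrite /frame_sum !mulr_sumr -big_split; apply: ler_sum => m _ /=.
    have -> : trunc ip e N f = f - r by rewrite /r subKr.
    have := le_normcD (ip f (g m)) (- ip r (g m)); rewrite normcN -ipBl.
    move=> le1; apply: (@le_trans _ _ ((normc (ip f (g m)) + normc (ip r (g m))) ^+ 2)).
      by rewrite lerXn2r ?nnegrE ?addr_ge0 ?normc_ge0.
    have := sqr_ge0 (normc (ip f (g m)) - normc (ip r (g m))).
    by rewrite sqrrB sqrrD; lra.
  by have := hL K; have := up' r K; lra.
rewrite pyth -/r -!expr2; lra.
Unshelve. all: by end_near. Qed.

End FrameDensity.

(** The partial products decrease to a limit which is at least the infimum, so the infimum itself
    serves as [delta] for every [N]. *)
Lemma uniformly_separated_finite (R : realType) (lam : nat -> R[i]) :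
  (forall j, normc (lam j) < 1) -> uniformly_separated lam ->
  exists2 delta : R, 0 < delta & forall N (j : 'I_N),
    delta <= \prod_(k : 'I_N | k != j) pseudo_dist (lam j) (lam k).
Proof.
move=> lam1; rewrite /uniformly_separated; set E := (X in inf X) => E0.
exists (inf E) => // N j.
pose P n : R := \prod_(0 <= k < n | k != j) pseudo_dist (lam j) (lam k).
have P0 n : 0 <= P n by apply: prodr_ge0 => k _; exact: pseudo_dist_ge0.
have Pdec : nonincreasing_seq P.
  apply/nonincreasing_seqP => n; rewrite /P big_mkcond big_nat_recr //= -big_mkcond.
  rewrite ler_piMr //; first exact: P0.
  by case: ifP => // _; rewrite pseudo_dist_le1.
have Pcv : cvgn P.
  by apply: nonincreasing_is_cvgn => //; exists 0 => _ [n _ <-]; exact: P0.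
have limP n : limn P <= P n by exact: nonincreasing_cvgn_ge.
have -> : \prod_(k : 'I_N | k != j) pseudo_dist (lam j) (lam k) = P N.
  by rewrite /P big_mkord; apply: eq_bigl => k.
apply: le_trans (limP N); apply: ge_inf; last by exists (j : nat).
(* [ge_inf] requires the set of limits to be bounded below; 0 is a bound, as all partial products
   are nonnegative. *)
exists 0 => _ [i _ <-]; apply: limr_ge; last first.
  by near=> n; apply: prodr_ge0 => k _; exact: normc_ge0.
apply: nonincreasing_is_cvgn; last first.
  by exists 0 => _ [n _ <-]; apply: prodr_ge0 => k _; exact: normc_ge0.
apply/nonincreasing_seqP => n; rewrite big_mkcond big_nat_recr //= -big_mkcond.
rewrite ler_piMr //; first by apply: prodr_ge0 => k _; exact: normc_ge0.
by case: ifP => // _; exact: pseudo_dist_le1.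
Unshelve. all: by end_near. Qed.

(** Only the entry [k] changes, and there [(x + y)^2 <= 2 x^2 + 2 y^2]. For [k != l] the inverse
    shear has the parameter [- s], so both directions of the change of basis are covered. *)
Lemma sum_normc_shear_le (R : realType) (n : nat) (f : 'I_n -> R[i]) (s : R[i]) (k l : 'I_n) :
  \sum_i normc (f i + (i == k)%:R * s * f l) ^+ 2
    <= (2 + 2 * normc s ^+ 2) * \sum_i normc (f i) ^+ 2.
Proof.
pose t i : R := (i == k)%:R * (normc s * normc (f l)) ^+ 2.
have bound i : normc (f i + (i == k)%:R * s * f l) ^+ 2 <= 2 * normc (f i) ^+ 2 + 2 * t i.
  rewrite /t; case: (i == k); rewrite ?mul1r; last first.
    by rewrite !mul0r addr0 mulr0 addr0; have := sqr_ge0 (normc (f i)); lra.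
  have := le_normcD (f i) (s * f l); rewrite normcM => h.
  have h0 : 0 <= normc s * normc (f l) by rewrite mulr_ge0 ?normc_ge0.
  apply: (@le_trans _ _ ((normc (f i) + normc s * normc (f l)) ^+ 2)).
    by rewrite lerXn2r ?nnegrE ?addr_ge0 ?normc_ge0.
  have := sqr_ge0 (normc (f i) - normc s * normc (f l)).
  by rewrite sqrrB sqrrD; lra.
apply: le_trans (ler_sum _ (fun i _ => bound i)) _.
rewrite big_split /= -!mulr_sumr [leRHS]mulrDl lerD2l -mulrA ler_wpM2l //.
rewrite (bigD1 k) //= [X in _ + X]big1 ?addr0 => [|i ik]; last by rewrite /t (negPf ik) mul0r.
rewrite /t eqxx mul1r exprMn ler_wpM2l ?sqr_ge0 // (bigD1 l) //= lerDl.
by apply: sumr_ge0 => i _; exact: sqr_ge0.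
Qed.

(** * Frame bounds for the orbit of [f0] *)

Section OrbitFrame.
Variables (R : realType) (H : completeNormedModType R[i]) (ip : {dot H for Num.conj}).
Hypothesis ip_norm : induces_norm ip.
Variables (lam : nat -> R[i]).
Hypothesis lam_disk : forall j : nat, normc (lam j) < 1.
Hypothesis lam_sep : uniformly_separated lam.
Variable (e : nat -> H).
Hypothesis e_onb : orthonormal_basis ip e.
Variable f0 : H.
Hypothesis f0_equiv : asymp_equiv (fun j : nat => normc (ip f0 (e j)))
                            (fun j : nat => Num.sqrt (1 - normc (lam j) ^+ 2)).
Variables (k l : nat) (tau : R[i]).
Hypothesis k_neq_l : k != l.
Hypothesis tau_neq : tau <> (lam k - lam l) * (ip f0 (e l) / ip f0 (e k)).
Local Notation nrm := (@normr_re R H).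

Lemma uniformly_separated_neq : lam k != lam l.
Proof.
have [delta d0 sep] := uniformly_separated_finite lam_disk lam_sep.
have kN : (k < (maxn k l).+1)%N by rewrite ltnS leq_maxl.
have lN : (l < (maxn k l).+1)%N by rewrite ltnS leq_maxr.
apply/eqP => kl; have := separated_inj (lam := fun i : 'I__ => lam i) d0 (sep _).
move=> /(_ _ (Ordinal kN) (Ordinal lN) kl) /(congr1 val) /= /eqP.
by rewrite (negPf k_neq_l).
Qed.

Lemma is_frame_orbit : is_frame ip (fun n => iter n (Ttau ip lam e k l tau) f0).
Proof.
have lam_kl := uniformly_separated_neq.
have [delta d0 sep] := uniformly_separated_finite lam_disk lam_sep.
have [c [C [c0 [C0 equiv]]]] := f0_equiv.
pose w j := Num.sqrt (1 - normc (lam j) ^+ 2).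
have w0 j : 0 < w j by rewrite sqrtr_gt0 one_sub_normc_sqr_gt0.
have ck : ip f0 (e k) != 0.
  apply/eqP => ck; have [_] := equiv k; rewrite ck (@normc0 R) mulr0.
  by rewrite leNgt (w0 k).
pose sigma := tau / (lam k - lam l).
(* the coefficients of [f0] in the basis of eigenvectors of [T_tau], in which
   [e k] is replaced by [e k + sigma *: e l] *)
pose d j := ip f0 (e j) - (j == l)%:R * sigma * ip f0 (e k).
have nkl : lam k - lam l != 0 by rewrite subr_eq0.
have dl : d l != 0.
  rewrite /d eqxx mul1r subr_eq0; apply/eqP => E; apply: tau_neq.
  by rewrite E /sigma; field; rewrite ck nkl.
(* [f0_equiv] bounds the ratio of [normc (d j)] to [w j] by [C^-1] and [c^-1] only for [j != l]; the
   ratio at [l], nonzero by the condition on [tau], is added to the minimum and the maximum. *)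
pose ql := normc (d l) / w l.
have ql0 : 0 < ql by rewrite divr_gt0 ?normc_gt0.
pose al := Num.min C^-1 ql.
pose be := Num.max c^-1 ql.
have al0 : 0 < al by rewrite lt_min invr_gt0 C0.
have be0 : 0 < be by rewrite lt_max ql0 orbT.
have dw j : al * w j <= normc (d j) <= be * w j.
  have [->|jl] := eqVneq j l.
    rewrite -[normc (d l)](mulfVK (lt0r_neq0 (w0 l))) -/ql.
    by rewrite !ler_pM2r ?w0 // ge_min le_max !lexx !orbT.
  have -> : d j = ip f0 (e j) by rewrite /d (negPf jl) !mul0r subr0.
  have [h1 h2] := equiv j; apply/andP; split.
    apply: (@le_trans _ _ (C^-1 * w j)); first by rewrite ler_pM2r ?w0 // ge_min lexx.
    by rewrite mulrC ler_pdivrMr // mulrC.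
  apply: (@le_trans _ _ (c^-1 * w j)); last by rewrite ler_pM2r ?w0 // le_max lexx.
  by rewrite mulrC ler_pdivlMr // mulrC.
pose kap := 2 + 2 * normc (Num.conj sigma) ^+ 2.
have kap0 : 0 < kap by rewrite /kap; have := sqr_ge0 (normc (Num.conj sigma)); lra.
pose lamN N (i : 'I_N) := lam i.
(* Inner products of [f] with the eigenvectors, so that [e k] is replaced by [e k + sigma *: e l];
   [sigma] is conjugated in the second argument of [ip]. *)
pose gf N f (i : 'I_N) := ip f (e i) + (i == k :> nat)%:R * Num.conj sigma * ip f (e l).
(* Dividing by [w i] normalizes the geometric sequences, as [moment_sum] expects. *)
pose a N f (i : 'I_N) := gf N f i * Num.conj (d i) / (w i)%:C.
have wC j : (w j)%:C != 0 by rewrite (inj_eq (@complexI R)) gt_eqF.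
pose T := Ttau ip lam e k l tau.
have sumE N f K : (maxn k l < N)%N ->
    frame_sum ip (fun n => iter n T f0) (trunc ip e N f) K = moment_sum (lamN N) (a N f) K.
  move=> kN; apply: eq_bigr => m _; congr (normc _ ^+ 2).
  have lN : (l < N)%N by apply: leq_ltn_trans kN; exact: leq_maxr.
  have kN' : (k < N)%N by apply: leq_ltn_trans kN; exact: leq_maxl.
  rewrite ip_suml_basis big_mkord.
  pose u i := ip f (e i) * Num.conj (d i) * Num.conj (lam i) ^+ m.
  pose v := Num.conj sigma * ip f (e l) * Num.conj (d k) * Num.conj (lam k) ^+ m.
  have dk : d k = ip f0 (e k) by rewrite /d (negPf k_neq_l) !mul0r subr0.
  (* In the basis [e] the cross term [v] sits at the index [l]; it carries powers of [lam k], so it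
     is regrouped at [k], where it completes [gf]. *)
  transitivity (\sum_(i < N) u i + v).
    have -> : v = \sum_(i < N) (if i == Ordinal lN then v else 0).
      by rewrite -big_mkcond big_pred1_eq.
    rewrite -big_split; apply: eq_bigr => i _ /=.
    rewrite (ip_iter_Ttau ip_norm e_onb lam_disk) // -val_eqE /=.
    rewrite -/sigma /u /v dk /d; move: (sigma) => s.
    have [->|_] := eqVneq (i : nat) l.
      by rewrite !mul1r !conjE; ring.
    by rewrite !mul0r addr0 subr0 addr0 !conjE; ring.
  have -> : v = \sum_(i < N) (if i == Ordinal kN' then v else 0).
    by rewrite -big_mkcond big_pred1_eq.
  rewrite -big_split; apply: eq_bigr => i _ /=.
  rewrite -val_eqE /= /a /gf /u /v -[wt (lamN N) i]/(w i) mulfVK // /lamN.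
  have [->|_] := eqVneq (i : nat) k; first by rewrite mul1r; ring.
  by rewrite !mul0r !addr0.
have gle N f : (maxn k l < N)%N -> nrm (trunc ip e N f) ^+ 2 <=
    kap * \sum_i normc (gf N f i) ^+ 2 /\
    \sum_i normc (gf N f i) ^+ 2 <= kap * nrm (trunc ip e N f) ^+ 2.
  move=> kN; rewrite (normr_re_trunc ip_norm e_onb).
  have lN : (l < N)%N by apply: leq_ltn_trans kN; exact: leq_maxr.
  have kN' : (k < N)%N by apply: leq_ltn_trans kN; exact: leq_maxl.
  split; last exact: (sum_normc_shear_le (fun i => ip f (e i)) _ (Ordinal kN') (Ordinal lN)).
  (* The shear with the opposite sign recovers the coordinates of [f] from [gf]. *)
  have := sum_normc_shear_le (gf N f) (- Num.conj sigma) (Ordinal kN') (Ordinal lN).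
  rewrite normcN -/kap; apply: le_trans; apply: ler_sum => i _.
  rewrite -val_eqE /= {2}/gf /= (eq_sym l) (negPf k_neq_l) !mul0r addr0 /gf.
  by rewrite mulrN mulNr addrK.
have aE N f : al ^+ 2 * \sum_i normc (gf N f i) ^+ 2 <= \sum_i normc (a N f i) ^+ 2 /\
    \sum_i normc (a N f i) ^+ 2 <= be ^+ 2 * \sum_i normc (gf N f i) ^+ 2.
  have aiE (i : 'I_N) : normc (a N f i) ^+ 2 = (normc (d i) / w i) ^+ 2 * normc (gf N f i) ^+ 2.
    by rewrite /a 2!normcM normc_conj normcV normc_real ger0_norm ?(ltW (w0 i)) //; ring.
  have q (i : 'I_N) : al <= normc (d i) / w i <= be.
    by rewrite ler_pdivlMr // ler_pdivrMr // dw.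
  rewrite !mulr_sumr; split; apply: ler_sum => i _; rewrite aiE ler_wpM2r ?sqr_ge0 //;
    have /andP[q1 q2] := q i; have q0 := le_trans (ltW al0) q1;
    by rewrite lerXn2r ?nnegrE ?(ltW al0) ?(ltW be0).
have lamN_disk N i : normc (lamN N i) < 1 by exact: lam_disk.
(* Each constant combines a Gram bound, a comparison of [d] with [w] ([al] or [be]) and the shear
   bound [kap]. Truncations start where both [k] and [l] are included. *)
apply: (@is_frame_of_trunc _ _ _ ip_norm _ e_onb _ (delta ^+ 4 / 8 * al ^+ 2 / kap)
    (8 / delta ^+ 2 * be ^+ 2 * kap) (maxn k l).+1).
- by rewrite !(divr_gt0, mulr_gt0, exprn_gt0).
- by rewrite !(divr_gt0, mulr_gt0, exprn_gt0).
- move=> f N K kN; rewrite sumE //.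
  apply: le_trans (moment_sum_le_gram (lamN_disk N) _ _) _.
  apply: le_trans (separated_gram_le (lamN_disk N) d0 (sep N) _) _.
  rewrite -(mulrA _ kap) -(mulrA _ (be ^+ 2)) ler_wpM2l ?divr_ge0 ?sqr_ge0 //.
  have [_ h] := aE N f; apply: le_trans h _; rewrite ler_wpM2l ?sqr_ge0 //.
  by have [] := gle N f kN.
- move=> f N L kN hL.
  have hL' K : moment_sum (lamN N) (a N f) K <= L by rewrite -sumE.
  apply: le_trans (gram_le_of_moment_sum (lamN_disk N) hL').
  apply: le_trans (separated_gram_ge (lamN_disk N) d0 (sep N) _).
  rewrite -[X in X * _ <= _]mulrA -[leLHS]mulrA ler_wpM2l ?divr_ge0 ?exprn_ge0 ?(ltW d0) //.
  have [h _] := aE N f; apply: le_trans h; rewrite -mulrA ler_wpM2l ?sqr_ge0 //.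
  by rewrite mulrC ler_pdivrMr // mulrC; have [] := gle N f kN.
Qed.

End OrbitFrame.

Local Close Scope complex_scope.

Theorem theorem5p4 (R : realType) (H : completeNormedModType R[i])
    (ip : {dot H for Num.conj}) (ip_norm : induces_norm ip)
    (H_sep : separable H) (H_inf : infinite_dimensional H)
    (lam : nat -> R[i]) (lam_disk : forall j : nat, normc (lam j) < 1)
    (lam_sep : uniformly_separated lam)
    (e : nat -> H) (e_onb : orthonormal_basis ip e)
    (f0 : H)
    (f0_equiv : asymp_equiv (fun j : nat => normc (ip f0 (e j)))
                            (fun j : nat => Num.sqrt (1 - normc (lam j) ^+ 2)))
    (k l : nat) (k_neq_l : k <> l)
    (tau : R[i])
    (tau_neq : tau <> (lam k - lam l) * (ip f0 (e l) / ip f0 (e k))) :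
  (forall f : H, cvgn (diag_series ip lam e f)) /\
  bounded_operator (Ttau ip lam e k l tau) /\
  is_frame ip (fun n : nat => iter n (Ttau ip lam e k l tau) f0) /\
  (tau <> 0 -> ~ normal_operator ip (Ttau ip lam e k l tau)).
Proof.
have /eqP kl := k_neq_l.
have lam_kl := uniformly_separated_neq lam_disk lam_sep kl.
split; first exact: cvg_diag_series.
split; first exact: bounded_Ttau.
split; first exact: is_frame_orbit.
exact: not_normal_Ttau.
Qed.
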